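(* Let $p$ be a prime, let $k$ be a positive integer, and let $r_1\le r_2\le\dots\le r_t$ be positive integers ($t\ge 1$). Then $$\psi_k(\mathbb{Z}_{p^{r_1}}\times\mathbb{Z}_{p^{r_2}}\times\dots\times\mathbb{Z}_{p^{r_t}})=\psi_k\big((\mathbb{Z}_{p^{r_1}})^{t}\big)+p^{r_1}\Big(\psi_k(\mathbb{Z}_{p^{r_2}}\times\dots\times\mathbb{Z}_{p^{r_t}})-\psi_k\big((\mathbb{Z}_{p^{r_1}})^{t-1}\big)\Big),$$ where for every positive integer $s$ $$\psi_k\big((\mathbb{Z}_{p^{r_1}})^{s}\big)=\frac{p^{sr_1+s+r_1k+k}-p^{sr_1+kr_1+k}+p^k-1}{p^{s+k}-1}.$$
   Context: For a finite group $G$ and a positive integer $k$, $\psi_k(G)=\sum_{g\in G} o(g)^k$, where $o(g)$ denotes the order of the element $g$. $\mathbb{Z}_m$ denotes the cyclic group of order $m$, and $(\mathbb{Z}_{m})^{s}$ denotes the direct product of $s$ copies of $\mathbb{Z}_m$; an empty direct product is the trivial group. *)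

(* Defs.v *)
From mathcomp Require Import all_boot all_order all_algebra all_fingroup.

Set Implicit Arguments.
Unset Strict Implicit.
Unset Printing Implicit Defensive.

Definition psi (k : nat) (gT : finGroupType) (G : {set gT}) : nat :=
  \sum_(g in G) #[g]%g ^ k.

(* The external direct product Z_{m_0} x ... x Z_{m_(n-1)} of the additive
   groups 'Z_(m_i), for m = [:: m_0; ...; m_(n-1)]; it is the trivial group
   for m = [::]. Since 'Z_0 and 'Z_1 have two elements in MathComp, it has its
   intended meaning only when all the moduli are at least 2. *)
Definition prodZ (m : seq nat) : finGroupType :=
  {dffun forall i : 'I_(size m), 'Z_(nth 0 m i)}.

Definition powZ (m s : nat) : finGroupType := prodZ (nseq s m).

(* Main.v *)
(* In an abelian p-group let T_j be the number of g with g^(p^j) = 1; there are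
   T_(j+1) - T_j elements of order p^(j+1), so psi_k is
   1 + sum_j p^((j+1)k) (T_(j+1) - T_j), and for a product of the Z_(p^r)
   T_j is the product of the p^(min(j,r)). Summing all four psi_k over the same
   range of j, the recurrence holds term by term: for j < r1 every torsion count
   involved is that of a power of Z_(p^r1), and for j >= r1 the factor Z_(p^r1)
   contributes the constant p^r1. The closed form is the sum for
   (Z_(p^r1))^s. *)
Require Import Defs.
From mathcomp Require Import all_boot all_order all_algebra all_fingroup.
From mathcomp Require Import all_solvable.
From mathcomp Require Import ring.

Import Order.TTheory GRing.Theory Num.Theory.

Local Open Scope ring_scope.

Definition num_torsion (gT : finGroupType) (d : nat) : nat :=
  #|[set x : gT | (x ^+ d == 1)%g]|.

(** Induction on [n]: an element killed by [p ^ n.+1] but not by [p ^ n] has order exactly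
    [p ^ n.+1], so each step adds a constant summand times the growth of the torsion count. *)
Lemma sum_order_torsion (p k n : nat) (gT : finGroupType) :
  prime p ->
  (\sum_(g : gT | (g ^+ (p ^ n) == 1)%g) (#[g]%g ^ k)%N)%:R
    = 1 + \sum_(j < n) p%:R ^+ (j.+1 * k)
            * ((num_torsion gT (p ^ j.+1))%:R - (num_torsion gT (p ^ j))%:R)
    :> rat.
Proof.
move=> p_pr; elim: n => [|n IHn].
  rewrite big_ord0 addr0 (big_pred1 1%g) ?order1 ?exp1n //.
have sub (g : gT) : ((g ^+ (p ^ n) == 1) -> (g ^+ (p ^ n.+1) == 1))%g.
  by rewrite -!order_dvdn => /dvdn_trans; apply; rewrite expnS dvdn_mull.
rewrite big_ord_recr /= addrA -IHn (bigID (fun g => g ^+ (p ^ n) == 1)%g) /=.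
rewrite natrD; congr (_ + _).
  congr (_%:R); apply: eq_bigl => g.
  by case: eqP (sub g) => [_ ->|]; rewrite ?andbF.
rewrite (eq_bigr (fun=> (p ^ (n.+1 * k))%N)); last first.
  move=> g; rewrite -!order_dvdn => /andP[/(dvdn_pfactor _ _ p_pr)[m le_mn ->]].
  rewrite dvdn_Pexp2l ?prime_gt1 // -ltnNge => lt_nm.
  by rewrite (@anti_leq m n.+1) ?le_mn // -expnM.
rewrite sum_nat_const natrM natrX mulrC; congr (_ * _).
(* The rational difference becomes a truncated subtraction in [nat], which is harmless since the
   torsion sets are nested. *)
rewrite -natrB; last first.
  by apply/subset_leq_card/subsetP => g; rewrite !inE; apply: sub.
congr (_%:R); rewrite /num_torsion -cardsDS; last first.
  by apply/subsetP => g; rewrite !inE; apply: sub.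
by rewrite -cardsE; apply: eq_card => g; rewrite !inE andbC.
Qed.

(** With [q = m %/ gcdn d m], which is coprime to [d %/ gcdn d m], [m] divides [x * d] iff [q]
    divides [x]; the solutions are the multiples of [q] modulo [m]. *)
Lemma num_torsion_Zp (m d : nat) :
  (1 < m)%N -> num_torsion 'Z_m d = gcdn d m.
Proof.
move=> m_gt1; have m_gt0 := ltnW m_gt1.
have g_gt0 : (0 < gcdn d m)%N by rewrite gcdn_gt0 m_gt0 orbT.
pose q := (m %/ gcdn d m)%N.
have mE : m = (gcdn d m * q)%N by rewrite mulnC divnK ?dvdn_gcdr.
have dE : d = (gcdn d m * (d %/ gcdn d m))%N by rewrite mulnC divnK ?dvdn_gcdl.
have q_gt0 : (0 < q)%N by move: m_gt0; rewrite {1}mE muln_gt0 => /andP[].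
have co_q : coprime q (d %/ gcdn d m).
  by rewrite /coprime -(eqn_pmul2l g_gt0) muln1 muln_gcdr -mE -dE gcdnC.
have dvd_q (i : nat) : (m %| i * d)%N = (q %| i)%N.
  by rewrite {1}mE {2}dE mulnCA dvdn_pmul2l // Gauss_dvdl.
have tors (x : 'Z_m) : (x ^+ d == 1)%g = (q %| x)%N.
  by rewrite Zp_expg -val_eqE /= [in X in (_ %% X)%N]Zp_cast // -dvd_q.
rewrite /num_torsion -sum1dep_card big_mkcond /=.
under eq_bigr => x _ do rewrite tors.
rewrite -(big_mkord xpredT (fun i => if (q %| i)%N then 1%N else 0%N)) Zp_cast //.
transitivity (m %/ q)%N; last by rewrite {1}mE mulnK.
(* [divn_count_dvd] counts over 1, ..., m and the residues run over 0, ..., m - 1; the end terms 0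
   and m are both multiples of [q]. *)
rewrite divn_count_dvd big_ltn // big_nat_recr //= dvdn0 addnC.
rewrite {3}mE dvdn_mull //; congr (_ + _)%N.
Qed.

Lemma prodZX (m : seq nat) (x : prodZ m) (d : nat) (i : 'I_(size m)) :
  (x ^+ d)%g i = (x i ^+ d)%g.
Proof.
elim: d => [|d IHd]; first by rewrite !expg0 ffunE.
by rewrite !expgS ffunE IHd.
Qed.

Lemma num_torsion_prodZ (m : seq nat) (d : nat) :
  num_torsion (prodZ m) d = (\prod_(n <- m) num_torsion 'Z_n d)%N.
Proof.
rewrite (big_nth 0%N) big_mkord.
pose F (i : 'I_(size m)) := [set x : 'Z_(nth 0 m i) | (x ^+ d == 1)%g].
rewrite -(cardsXn F); congr #|pred_of_set _|; apply/setP => x.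
rewrite inE; apply/eqP/setXnP => [x_tors i | F_x].
  by rewrite inE -prodZX x_tors ffunE.
apply/ffunP => i; rewrite prodZX ffunE; apply/eqP.
by have := F_x i; rewrite inE.
Qed.

Lemma num_torsion_pprodZ (p j : nat) (rs : seq nat) :
  prime p -> all (leq 1) rs ->
  num_torsion (prodZ [seq (p ^ r)%N | r <- rs]) (p ^ j)
    = (\prod_(r <- rs) p ^ minn j r)%N.
Proof.
move=> p_pr /allP rs_gt0; rewrite num_torsion_prodZ big_map big_seq [RHS]big_seq.
apply: eq_bigr => r /rs_gt0 r_gt0; have p_gt1 := prime_gt1 p_pr.
rewrite num_torsion_Zp; last by rewrite -(exp1n r) ltn_exp2r.
case: (leqP j r) => [le_jr | /ltnW le_rj].
  by apply/gcdn_idPl; rewrite dvdn_exp2l.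
by apply/gcdn_idPr; rewrite dvdn_exp2l.
Qed.

(** Any common bound [n] of the exponents works, since [p ^ n] then kills the whole group. Leaving
    it free lets different products share one summation range. *)
Lemma psi_pprodZ (p k n : nat) (rs : seq nat) :
  prime p -> all (leq 1) rs -> all (geq n) rs ->
  (psi k [set: prodZ [seq (p ^ r)%N | r <- rs]])%:R
    = 1 + \sum_(j < n) p%:R ^+ (j.+1 * k)
            * (\prod_(r <- rs) p%:R ^+ minn j.+1 r
               - \prod_(r <- rs) p%:R ^+ minn j r) :> rat.
Proof.
move=> p_pr rs_gt0 /allP rs_len.
have all_tors (g : prodZ [seq (p ^ r)%N | r <- rs]) : (g ^+ (p ^ n) == 1)%g.
  apply/eqP/ffunP => i; rewrite prodZX ffunE; apply/eqP; rewrite -order_dvdn.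
  have lt_i : (i < size rs)%N by have := ltn_ord i; rewrite [X in (_ < X)%N]size_map.
  have r_rs := mem_nth 0%N lt_i; apply: dvdn_trans (order_dvdG (in_setT _)) _.
  rewrite cardsT card_ord (nth_map 0%N) // Zp_cast; first exact/dvdn_exp2l/rs_len.
  by rewrite -(exp1n (nth 0%N rs i)) ltn_exp2r ?prime_gt1 // (allP rs_gt0).
rewrite /psi (eq_bigl (fun g => (g ^+ (p ^ n) == 1)%g)); last first.
  by move=> g; rewrite all_tors inE.
rewrite sum_order_torsion //; congr (_ + _); apply: eq_bigr => j _.
rewrite !num_torsion_pprodZ // !natr_prod.
by congr (_ * (_ - _)); apply: eq_bigr => r _; rewrite natrX.
Qed.

Lemma psi_powZ (p k n r s : nat) :
  prime p -> (0 < r <= n)%N ->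
  (psi k [set: powZ (p ^ r) s])%:R
    = 1 + \sum_(j < n) p%:R ^+ (j.+1 * k)
            * (p%:R ^+ minn j.+1 r ^+ s - p%:R ^+ minn j r ^+ s) :> rat.
Proof.
move=> p_pr /andP[r_gt0 le_rn]; rewrite /powZ -[nseq _ _](map_nseq _ (expn p)).
rewrite (psi_pprodZ _ _ n) ?all_nseq /= ?r_gt0 ?le_rn ?orbT //.
congr (_ + _); apply: eq_bigr => j _; rewrite !big_nseq.
by rewrite !iter_mulr_1.
Qed.

Theorem theorem1p4 (p k t r1 : nat) (rs : seq nat)
    (p_prime : prime p) (k_gt0 : (0 < k)%N)
    (size_r : size (r1 :: rs) = t)
    (r_gt0 : all (leq 1) (r1 :: rs))
    (r_sorted : sorted leq (r1 :: rs)) :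
  ((psi k [set: prodZ [seq (p ^ r)%N | r <- r1 :: rs]])%:R : rat)
    = (psi k [set: powZ (p ^ r1) t])%:R
      + p%:R ^+ r1 * ((psi k [set: prodZ [seq (p ^ r)%N | r <- rs]])%:R
                      - (psi k [set: powZ (p ^ r1) (t - 1)])%:R)
  /\ (forall s : nat, (0 < s)%N ->
        ((psi k [set: powZ (p ^ r1) s])%:R : rat)
        = (p%:R ^+ (s * r1 + s + r1 * k + k)
           - p%:R ^+ (s * r1 + k * r1 + k) + p%:R ^+ k - 1)
          / (p%:R ^+ (s + k) - 1)).
Proof.
have [r1_gt0 rs_gt0] : (0 < r1)%N /\ all (leq 1) rs by move: r_gt0 => /andP[].
have r1_le : all (leq r1) rs by apply: order_path_min r_sorted; apply: leq_trans.
split=> [|s s_gt0]; last first.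
  have den_neq0 : p%:R ^+ (s + k) - 1 != 0 :> rat.
    rewrite subr_eq0 gt_eqF // exprn_egt1 ?ltr1n ?prime_gt1 //.
    by rewrite addn_eq0 negb_and -!lt0n s_gt0.
  (* The bound [r1] itself is chosen, so that every minimum reduces to [j] or [j.+1]. *)
  apply: (mulIf den_neq0); rewrite divfK // (psi_powZ _ _ r1) ?r1_gt0 ?leqnn //.
  rewrite (eq_bigr (fun j : 'I_r1 => p%:R ^+ (j.+1 * k)
             * (p%:R ^+ j.+1 ^+ s - p%:R ^+ j ^+ s))); last first.
    move=> j _; rewrite (minn_idPl (ltn_ord j)).
    by rewrite (minn_idPl (ltnW (ltn_ord j))).
  (* Free of minima, the identity also makes sense at exponent 0, where both sides are
     [p ^ (s + k) - 1]; the induction starts there. *)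
  elim: {r_gt0 r_sorted size_r r1_le} r1 {r1_gt0} => [|n IHn].
    by rewrite big_ord0 !muln0 mul0n !exprD; ring.
  rewrite big_ord_recr /= addrA mulrDl IHn -!exprM.
  rewrite !(mulnS, mulSn) ![(k * n)%N]mulnC ![(s * n)%N]mulnC !exprD.
  by ring.
pose n := (\max_(r <- r1 :: rs) r)%N.
have le_n : all (geq n) (r1 :: rs).
  by apply/allP => r r_in; apply: (leq_bigmax_seq (F := id)).
have [r1_len rs_len] : (r1 <= n)%N /\ all (geq n) rs by move: le_n => /andP[].
rewrite !(psi_pprodZ _ _ n) // !(psi_powZ _ _ n) ?r1_gt0 //.
rewrite -size_r /= subn1 /= opprD addrACA subrr add0r -sumrB mulr_sumr.
rewrite -addrA -big_split /=; congr (_ + _); apply: eq_bigr => j _.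
(* The bound is not strict, so that for [j < r1] it covers both [j] and [j.+1]. *)
have prod_le i : (i <= r1)%N ->
    \prod_(r <- rs) p%:R ^+ minn i r = p%:R ^+ i ^+ size rs :> rat.
  move=> le_ir1; rewrite big_seq (eq_bigr (fun=> p%:R ^+ i)) => [|r].
    by rewrite -big_seq big_const_seq count_predT iter_mulr_1.
  by move/(allP r1_le) => le_r1r; rewrite (minn_idPl (leq_trans le_ir1 le_r1r)).
rewrite !big_cons; case: (ltnP j r1) => [lt_jr1 | le_r1j].
  rewrite !prod_le ?(ltnW lt_jr1) // !(minn_idPl _) ?(ltnW lt_jr1) // !exprS.
  by ring.
(* Both minima with [r1] are now [r1]: the terms of the powers of [Z_(p^r1)] vanish and [p ^ r1]
   factors out. *)
rewrite !(minn_idPr _) ?(leqW le_r1j) // !exprS.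
by ring.
Qed.
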